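(* For every constant $\varepsilon_0>0$ there is a constant $c>0$ such that for all $k\ge 2$, $\alpha\in(0,1]$ and $\varepsilon\in(0,\varepsilon_0]$, any sequentially interactive $\varepsilon$-locally differentially private uniformity tester over domain $[k]$ with distance parameter $\alpha$ requires $m\ge c\,\frac{k}{\alpha^2\varepsilon^2}$ samples.
   Context: Uniformity testing: given $m$ i.i.d. samples from an unknown distribution $p$ on $[k]$, a tester must output ''uniform'' with probability $\ge 2/3$ when $p=U_k$ (uniform on $[k]$) and ''non-uniform'' with probability $\ge 2/3$ when $d_{TV}(p,U_k)\ge\alpha$. Local privacy: each sample $s_t$ is held by a separate user. An $\varepsilon$-randomizer is an $\varepsilon$-differentially private randomized map taking a single data point as input. A sequentially interactive protocol processes users once each in order: at time $t$ it chooses a randomizer $R_t$ as a function of the transcript so far (the pairs $(R_{t'},y_{t'})$ for $t'<t$, plus public randomness), and user $t$ publishes $y_t=R_t(s_t)$. The protocol is $\varepsilon$-locally differentially private if its transcript is an $\varepsilon$-differentially private function of the samples (equivalently, each $R_t$ is an $\varepsilon$-randomizer). The tester's output is a function of the transcript.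
   Formalization: The range α∈(0,1] is replaced by 0<α≤α₀ with α≤1−1/k, for an arbitrary α₀<1, and c depends on ε₀ and α₀: for α>1−1/k no distribution is α-far, so m=0 suffices, and at α=1−1/k O(1/ε²) samples suffice for every k. *)

(* Defs.v *)
From HB Require Import structures.
From mathcomp Require Import all_boot all_order all_algebra.
From mathcomp Require Import all_classical all_reals all_analysis.
From mathcomp Require Import measurable_realfun.
Set Implicit Arguments.
Unset Strict Implicit.
Unset Printing Implicit Defensive.
Import Order.TTheory GRing.Theory Num.Theory.
Import numFieldNormedType.Exports.
Local Open Scope classical_set_scope.
Local Open Scope ring_scope.

Section distributions.
Context (R : realType) (k : nat).
Implicit Types p q : 'I_k -> R.

Definition is_distribution p : Prop :=
  (forall x, 0 <= p x) /\ \sum_(x < k) p x = 1.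

Definition uniform_distribution : 'I_k -> R := fun=> k%:R^-1.

Definition dTV p q : R := 2^-1 * \sum_(x < k) `|p x - q x|.

End distributions.

Arguments uniform_distribution R k : clear implicits.

Definition neighbors (m k : nat) (s s' : {ffun 'I_m -> 'I_k}) : bool :=
  #|[set i | s i != s' i]| == 1%N.

Definition differentially_private (R : realType) (m k : nat)
    (d : measure_display) (T : measurableType d) (eps : R)
    (M : {ffun 'I_m -> 'I_k} -> probability T R) : Prop :=
  forall s s', neighbors s s' ->
  forall E : set T, measurable E ->
    (M s E <= (expR eps)%:E * M s' E)%E.

Section append.
Context (d d' : measure_display) (Omega : measurableType d)
  (Y : measurableType d').

Definition append (t : nat) (hy : (Omega * t.-tuple Y) * Y) :
    Omega * t.+1.-tuple Y :=
  (hy.1.1, [tuple of rcons hy.1.2 hy.2]).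

Lemma measurable_append t : measurable_fun setT (@append t).
Proof.
apply/measurable_fun_pairP; split => /=.
  rewrite [X in measurable_fun _ X](_ : _ = fst \o fst)//.
  exact: measurableT_comp.
apply/measurable_fun_tnthP => i.
have [it|it] := ltnP i t.
  rewrite [X in measurable_fun _ X](_ : _ =
    (@tnth t Y ^~ (Ordinal it)) \o (snd \o fst)); last first.
    apply/funext => -[[w h] y] /=.
    by rewrite !(tnth_nth y) /= nth_rcons size_tuple it.
  apply: measurableT_comp; first exact: measurable_tnth.
  exact: measurableT_comp.
rewrite [X in measurable_fun _ X](_ : _ = snd)//.
apply/funext => -[[w h] y] /=; rewrite (tnth_nth y) /= nth_rcons size_tuple.
have -> : (i : nat) = t by apply/eqP; rewrite eqn_leq it -ltnS ltn_ord.
by rewrite ltnn eqxx.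
Qed.

End append.

Section transcript_nil.
Context (d d' : measure_display) (Omega : measurableType d)
  (Y : measurableType d') (R : realType).
Variable coin : probability Omega R.

Definition transcript_nil (E : set (Omega * 0.-tuple Y)) : \bar R :=
  coin [set w | E (w, [tuple])].

Let meas_nil :
  measurable_fun setT (fun w : Omega => (w, [tuple]) : Omega * 0.-tuple Y).
Proof.
apply/measurable_fun_pairP.
by split; [exact: measurable_id|exact: measurable_cst].
Qed.

Let nil0 : transcript_nil set0 = 0%E.
Proof. exact: measure0. Qed.

Let nil_ge0 E : (0 <= transcript_nil E)%E.
Proof. exact: measure_ge0. Qed.

Let nil_sigma_additive : semi_sigma_additive transcript_nil.
Proof.
exact: (@measure_semi_sigma_additive _ _ _ (pushforward coin
  (mfun_Sub (mem_set meas_nil) : {mfun _ >-> _}))).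
Qed.

HB.instance Definition _ := isMeasure.Build _ _ _ transcript_nil
  nil0 nil_ge0 nil_sigma_additive.

Let nilT : transcript_nil setT = 1%E.
Proof. exact: probability_setT. Qed.

HB.instance Definition _ := Measure_isProbability.Build _ _ _ transcript_nil
  nilT.

End transcript_nil.

Section transcript_step.
Context (d d' : measure_display) (Omega : measurableType d)
  (Y : measurableType d') (R : realType) (t : nat).
Variable mu : probability (Omega * t.-tuple Y)%type R.
Variable K : R.-pker (Omega * t.-tuple Y)%type ~> Y.

Definition transcript_step (E : set (Omega * t.+1.-tuple Y)) : \bar R :=
  (\int[mu]_h K h [set y | E (append (h, y))])%E.

Implicit Types (E : set (Omega * t.+1.-tuple Y)%type)
  (h : (Omega * t.-tuple Y)%type).

Let xsecE E h : [set y | E (append (h, y))] =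
  xsection ((@append _ _ Omega Y t) @^-1` E) h.
Proof. by apply/seteqP; split => y; rewrite /xsection/= inE. Qed.

Let meas_pre E : measurable E -> measurable ((@append _ _ Omega Y t) @^-1` E).
Proof.
by move=> mE; rewrite -[X in measurable X]setTI; exact: measurable_append.
Qed.

Let meas_sec E h : measurable E -> measurable [set y | E (append (h, y))].
Proof.
by move=> mE; rewrite xsecE; apply: measurable_xsection; exact: meas_pre.
Qed.

Let meas_int E : measurable E ->
  measurable_fun [set: Omega * t.-tuple Y]
    (fun h => K h [set y | E (append (h, y))]).
Proof.
move=> mE; rewrite [X in measurable_fun _ X](_ : _ =
    fun h => K h (xsection ((@append _ _ Omega Y t) @^-1` E) h)); last first.
  by apply/funext => h; rewrite xsecE.
by apply: measurable_fun_xsection_finite_kernel; rewrite inE; exact: meas_pre.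
Qed.

Let step0 : transcript_step set0 = 0%E.
Proof. by apply: integral0_eq => h _; exact: measure0. Qed.

Let step_ge0 E : (0 <= transcript_step E)%E.
Proof. by apply: integral_ge0 => h _; exact: measure_ge0. Qed.

Let step_sigma_additive : semi_sigma_additive transcript_step.
Proof.
move=> F mF tF mUF.
rewrite [X in _ --> X](_ : _ =
    (\sum_(0 <= n <oo) transcript_step (F n))%E); last first.
  rewrite /transcript_step -integral_nneseries//; last first.
    by move=> n; exact: meas_int.
  apply: eq_integral => h _.
  rewrite (_ : [set y | _] = \bigcup_n [set y | F n (append (h, y))])//.
  apply/esym/cvg_lim => //; apply: measure_sigma_additive.
    by move=> n; exact: meas_sec.
  apply/trivIsetP => i j _ _ ij.
  move/trivIsetP : tF => /(_ i j I I ij) FF0.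
  apply/seteqP; split => // y [Fi Fj].
  by have : (F i `&` F j) (append (h, y)) by []; rewrite FF0.
by apply: is_cvg_nneseries => n _ _; exact: step_ge0.
Qed.

HB.instance Definition _ := isMeasure.Build _ _ _ transcript_step
  step0 step_ge0 step_sigma_additive.

Let stepT : transcript_step setT = 1%E.
Proof.
rewrite /transcript_step.
under eq_integral => h _.
  rewrite (_ : [set y | _] = setT)// prob_kernel.
  over.
by rewrite integral_cst//= mul1e probability_setT.
Qed.

HB.instance Definition _ := Measure_isProbability.Build _ _ _ transcript_step
  stepT.

End transcript_step.

(* [Omega] carries the public randomness.  [randomizer t x h] is the law of the
   message that user [t] publishes on data point [x] after the history
   [h = (w, (y_0, ..., y_(t-1)))].  The randomizers chosen so far are functions
   of the history, so they need not be recorded in it.  Randomizers with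
   different output spaces are covered by taking for [Y] their disjoint union.
   With [m] users only the [randomizer t] for [t < m] are used. *)
Record seq_protocol (R : realType) (k : nat) (d d' : measure_display)
    (Omega : measurableType d) (Y : measurableType d') := SeqProtocol {
  public_coin : probability Omega R ;
  randomizer : forall t : nat,
    'I_k -> R.-pker (Omega * t.-tuple Y)%type ~> Y }.

Section protocols.
Context (R : realType) (k : nat) (d d' : measure_display)
  (Omega : measurableType d) (Y : measurableType d').
Variable Pi : seq_protocol R k Omega Y.

Fixpoint transcript_of (t : nat) :
    ('I_t -> 'I_k) -> probability (Omega * t.-tuple Y)%type R :=
  match t return ('I_t -> 'I_k) -> probability (Omega * t.-tuple Y)%type R with
  | 0%N => fun=> @transcript_nil _ _ Omega Y R (public_coin Pi)
  | n.+1 => fun s =>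
      transcript_step (transcript_of (fun i => s (widen_ord (leqnSn n) i)))
        (randomizer Pi n (s ord_max))
  end.

Definition transcript (m : nat) (s : {ffun 'I_m -> 'I_k}) :
  probability (Omega * m.-tuple Y)%type R := transcript_of s.

Definition locally_private (m : nat) (eps : R) : Prop :=
  differentially_private eps (@transcript m).

(* probability that the output is [b] on [m] i.i.d. samples from [p] *)
Definition output_prob (m : nat) (out : Omega * m.-tuple Y -> bool)
    (p : 'I_k -> R) (b : bool) : \bar R :=
  (\sum_(s : {ffun 'I_m -> 'I_k})
     (\prod_(i < m) p (s i))%:E * transcript s [set h | out h = b])%E.

(* the output [true] stands for "uniform" *)
Definition uniformity_tester (m : nat) (alpha : R)
    (out : Omega * m.-tuple Y -> bool) : Prop :=
  [/\ measurable_fun setT out,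
      ((2 / 3)%:E <= output_prob out (uniform_distribution R k) true)%E &
      forall p : 'I_k -> R, is_distribution p ->
        alpha <= dTV p (uniform_distribution R k) ->
        ((2 / 3)%:E <= output_prob out p false)%E].

End protocols.

(* Main.v *)
Require Import Defs.
From HB Require Import structures.
From mathcomp Require Import all_boot all_order all_algebra all_fingroup.
From mathcomp Require Import all_classical all_reals all_analysis.
From mathcomp Require Import measurable_realfun.
From mathcomp Require Import ring lra.
Set Implicit Arguments.
Unset Strict Implicit.
Unset Printing Implicit Defensive.
Import Order.TTheory GRing.Theory Num.Theory.
Import numFieldNormedType.Exports.
Local Open Scope classical_set_scope.
Local Open Scope ring_scope.

(** The alternatives are p_z(x) = (1 + delta(z x)) / k, where z ranges over all
    permutations of [k] and delta is a fixed vector with zero sum; averaging over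
    z makes the operator norm of the family small.  No divergence between
    transcripts is used.  Instead, for [0,1]-valued F_z, one shows by induction
    on the number t of users that
      sum_z (E_{p_z} F_z)^2 <= sum_z E_U [F_z^2] + t * error.
    Taking the conditional mean over the last message turns F_z into a function
    of the shorter history; the increase of its second moment under U is at most
    a covariance term minus the conditional variance of F_z.  By privacy and the
    operator norm bound, the covariance terms summed over z are absorbed by the
    variances up to an error of order #z * alpha^2 * eps^2 / k.  With F_z the
    indicator of the answer "non-uniform" the left side is at least 4/9 * #z and
    the second moments on the right sum to at most 1/3 * #z. *)

(** * The hard family *)

Section quadratic_forms.
Variable R : realType.

(** A matrix and its transpose have the same operator norm. With [v] the transpose applied to [f],
    the square norm of [v] is the pairing of [f] with [D v]; AM-GM and the hypothesis for [v] bound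
    it by half of the claim plus half of itself. *)
Lemma dual_operator_bound (X Z : finType) (D : Z -> X -> R) (K : R) :
  0 < K ->
  (forall v : X -> R,
    \sum_z (\sum_x D z x * v x) ^+ 2 <= K * \sum_x v x ^+ 2) ->
  forall f : Z -> R, \sum_x (\sum_z D z x * f z) ^+ 2 <= K * \sum_z f z ^+ 2.
Proof.
move=> K0 HD f; pose v x := \sum_z D z x * f z.
pose w z := \sum_x D z x * v x.
have vw : \sum_x v x ^+ 2 = \sum_z f z * w z.
  under eq_bigr do rewrite expr2 {1}/v mulr_suml.
  rewrite exchange_big /=; apply: eq_bigr => z _.
  by rewrite /w mulr_sumr; apply: eq_bigr => x _; ring.
have : \sum_z f z * w z <=
    \sum_z (2^-1 * (K * f z ^+ 2) + 2^-1 * (K^-1 * w z ^+ 2)).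
  apply: ler_sum => z _; rewrite -subr_ge0.
  have -> : 2^-1 * (K * f z ^+ 2) + 2^-1 * (K^-1 * w z ^+ 2) - f z * w z =
      2^-1 * K * (f z - K^-1 * w z) ^+ 2.
    by field; rewrite gt_eqF.
  by rewrite mulr_ge0 ?sqr_ge0// mulr_ge0// ltW.
rewrite big_split /= -!mulr_sumr -vw.
have : K^-1 * \sum_z w z ^+ 2 <= \sum_x v x ^+ 2.
  by rewrite mulrC ler_pdivrMr// mulrC HD.
rewrite -/(v _); lra.
Qed.

(** The form is invariant under relabelling of [k], so its matrix [q] has one value on the diagonal
    and one off it. Zero row sums fix their ratio, and the trace fixes the diagonal. *)
Lemma sum_perm_quadratic_form (k : nat) (d v : 'I_k -> R) :
  (2 <= k)%N -> \sum_x d x = 0 ->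
  \sum_(s : {perm 'I_k}) (\sum_x d (s x) * v x) ^+ 2 <=
  #|{perm 'I_k}|%:R * (2 * (\sum_x d x ^+ 2) / k%:R) * \sum_x v x ^+ 2.
Proof.
move=> k2 d0.
have k0 : (0 < k)%N by exact: leq_trans k2.
have kR : (2 : R) <= k%:R by rewrite (ler_nat _ 2).
pose q x y := \sum_(s : {perm 'I_k}) d (s x) * d (s y).
have qinv (t : {perm 'I_k}) x y : q (t x) (t y) = q x y.
  rewrite {2}/q (reindex_inj (mulgI t)) /=.
  by apply: eq_bigr => s _; rewrite !permM.
have x0 : 'I_k := Ordinal k0.
pose a := q x0 x0.
have qd x : q x x = a by rewrite /a -(qinv (tperm x0 x) x0 x0) tpermL.
have a0 : 0 <= a by apply: sumr_ge0 => s _; rewrite -expr2 sqr_ge0.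
have row x : \sum_y q x y = 0.
  rewrite exchange_big /= big1// => s _.
  rewrite -mulr_sumr.
  by rewrite -(reindex_inj (@perm_inj _ s) (P := xpredT) (F := d))/= d0 mulr0.
have qo x y : x != y -> q x y = - (a / (k%:R - 1)).
  move=> xy; have := row x; rewrite (bigD1 x)//= qd.
  rewrite (eq_bigr (fun=> q x y)); last first.
    move=> z zx; rewrite -[RHS](qinv (tperm y z)) tpermL tpermD//.
    by rewrite eq_sym.
  rewrite sumr_const (_ : #|_| = k.-1); last first.
    by have := cardC1 x; rewrite card_ord.
  have kp : k.-1%:R = k%:R - 1 :> R by rewrite -subn1 natrB.
  rewrite -[_ *+ k.-1]mulr_natr kp => /eqP; rewrite addrC addr_eq0 => /eqP e.
  by rewrite -mulNr -e mulfK//; apply/eqP; lra.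
have ka : k%:R * a = #|{perm 'I_k}|%:R * \sum_x d x ^+ 2.
  transitivity (\sum_x q x x).
    by under eq_bigr do rewrite qd; rewrite sumr_const card_ord mulr_natl.
  rewrite exchange_big /= (eq_bigr (fun=> \sum_x d x ^+ 2)).
    by rewrite sumr_const mulr_natl.
  move=> s _; rewrite [RHS](reindex_inj (@perm_inj _ s)) /=.
  by apply: eq_bigr => x _; rewrite expr2.
set V := \sum_x v x ^+ 2.
have V0 : 0 <= V by apply: sumr_ge0 => x _; exact: sqr_ge0.
have -> : \sum_(s : {perm 'I_k}) (\sum_x d (s x) * v x) ^+ 2 =
    \sum_x \sum_y q x y * (v x * v y).
  under eq_bigr => s _.
    rewrite expr2 mulr_suml.
    under eq_bigr do rewrite mulr_sumr.
    over.
  rewrite exchange_big /=; apply: eq_bigr => x _.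
  rewrite exchange_big /=; apply: eq_bigr => y _.
  by rewrite mulr_suml; apply: eq_bigr => s _; ring.
(* Off the diagonal [q] equals [- b], so the form is (a + b) |v|^2 - b (sum v)^2, at most 2 a |v|^2
   because [b <= a] for k at least 2. *)
pose b := a / (k%:R - 1).
have ba : b <= a by rewrite /b ler_pdivrMr; [nra|lra].
have b0 : 0 <= b by rewrite /b divr_ge0//; lra.
have -> : \sum_x \sum_y q x y * (v x * v y) =
    (a + b) * V - b * (\sum_x v x) ^+ 2.
  transitivity (\sum_x ((a + b) * v x ^+ 2 - b * (v x * \sum_y v y))).
    apply: eq_bigr => x _; rewrite (bigD1 x)//= qd [in RHS](bigD1 x)//=.
    rewrite (eq_bigr (fun y => - b * v x * v y)); last first.
      by move=> y yx; rewrite qo 1?eq_sym// -/b; ring.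
    by rewrite -mulr_sumr; ring.
  rewrite sumrB -!mulr_sumr -/V -mulr_suml expr2; ring.
have -> : #|{perm 'I_k}|%:R * (2 * (\sum_x d x ^+ 2) / k%:R) = 2 * a.
  rewrite (_ : _ * _ = 2 * (#|{perm 'I_k}|%:R * \sum_x d x ^+ 2) / k%:R); last by ring.
  by rewrite -ka; field; apply/eqP; lra.
have := sqr_ge0 (\sum_x v x); nra.
Qed.

End quadratic_forms.

Section step_perturbation.
Variables (R : realType) (k s : nat) (lam : R).

(* [(1 + step_perturbation) / k] mixes the uniform distributions on [k] and on
   {0, ..., s-1} with weights [1 - lam] and [lam]. *)
Definition step_perturbation (i : 'I_k) : R :=
  lam * ((i < s)%:R * (k%:R / s%:R) - 1).

Hypotheses (s_gt0 : (0 < s)%N) (s_le : (s <= k)%N).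

Let sR : s%:R != 0 :> R. Proof. by rewrite pnatr_eq0 -lt0n. Qed.

Let sum_lt : \sum_(i < k) (i < s)%:R = s%:R :> R.
Proof.
rewrite -natr_sum; congr (_%:R).
rewrite -(big_mkord xpredT (fun i => (i < s : nat)%N)) /=.
rewrite (big_cat_nat (leq0n s) s_le)/= big_nat (eq_bigr (fun=> 1%N)); last first.
  by move=> i /andP[_ ->].
rewrite -big_nat sum_nat_const_nat subn0 muln1 big_nat big1 ?addn0//.
by move=> i /andP[si _]; rewrite ltnNge si.
Qed.

Lemma sum_step_perturbation : \sum_i step_perturbation i = 0.
Proof.
rewrite -mulr_sumr sumrB -mulr_suml sum_lt sumr_const card_ord.
by field.
Qed.

Lemma sum_sqr_step_perturbation :
  \sum_i step_perturbation i ^+ 2 = lam ^+ 2 * (k%:R ^+ 2 / s%:R - k%:R).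
Proof.
rewrite (eq_bigr (fun i : 'I_k => lam ^+ 2 * ((i < s)%:R *
    ((k%:R / s%:R) ^+ 2 - 2 * (k%:R / s%:R)) + 1))); last first.
  by move=> i _; rewrite /step_perturbation; case: (i < s)%N => /=; ring.
rewrite -mulr_sumr big_split /= -mulr_suml sum_lt sumr_const card_ord.
by congr (_ * _); field.
Qed.

(** Up to the factor 1 / (2 k) this is the distance of the perturbed distribution from uniform; its
    exact value dictates [lam]. *)
Lemma sum_norm_step_perturbation : 0 <= lam ->
  \sum_i `|step_perturbation i| = 2 * lam * (k%:R - s%:R).
Proof.
move=> lam0.
have ks : 1 <= k%:R / s%:R :> R.
  by rewrite ler_pdivlMr ?ltr0n// mul1r ler_nat.
rewrite (eq_bigr (fun i : 'I_k => lam * ((i < s)%:R *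
    (k%:R / s%:R - 2) + 1))); last first.
  move=> i _; rewrite /step_perturbation normrM ger0_norm//; congr (_ * _).
  case: (i < s)%N => /=.
    by rewrite mul1r ger0_norm; lra.
  by rewrite !mul0r sub0r normrN1 add0r.
rewrite -mulr_sumr big_split /= -mulr_suml sum_lt sumr_const card_ord.
by field.
Qed.

Lemma step_perturbation_geN1 i : 0 <= lam -> lam <= 1 ->
  -1 <= step_perturbation i.
Proof.
move=> lam0 lam1.
have : 0 <= (i < s)%:R * (k%:R / s%:R) :> R by rewrite mulr_ge0// divr_ge0.
rewrite /step_perturbation; nra.
Qed.

End step_perturbation.

(** * Means of bounded measurable functions *)

Section bounded_measurable.
Context (R : realType) (d : measure_display) (T : measurableType d).
Implicit Types f g : T -> R.

(** Boundedness gives integrability under every probability measure, so linearity of the integral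
    holds on this class without side conditions. *)
Definition bmf f : Prop :=
  measurable_fun setT f /\ exists M, forall x, `|f x| <= M.

Lemma bmf_cst (c : R) : bmf (fun=> c).
Proof. by split; [exact: measurable_cst|exists `|c|]. Qed.

Lemma bmfD f g : bmf f -> bmf g -> bmf (fun x => f x + g x).
Proof.
move=> [mf [M fM]] [mg [N gN]]; split; first exact: measurable_funD.
by exists (M + N) => x; rewrite (le_trans (ler_normD _ _))// lerD.
Qed.

Lemma bmfM f g : bmf f -> bmf g -> bmf (fun x => f x * g x).
Proof.
move=> [mf [M fM]] [mg [N gN]]; split; first exact: measurable_funM.
by exists (M * N) => x; rewrite normrM ler_pM.
Qed.

Lemma bmfZ (c : R) f : bmf f -> bmf (fun x => c * f x).
Proof. by move=> bf; apply: bmfM => //; exact: bmf_cst. Qed.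

Lemma bmfB f g : bmf f -> bmf g -> bmf (fun x => f x - g x).
Proof.
move=> bf bg; rewrite [X in bmf X](_ : _ = fun x => f x + -1 * g x).
  by apply: bmfD => //; exact: bmfZ.
by apply/funext => x; rewrite mulN1r.
Qed.

Lemma bmfX f n : bmf f -> bmf (fun x => f x ^+ n).
Proof.
move=> bf; elim: n => [|n IH]; first exact: bmf_cst.
rewrite [X in bmf X](_ : _ = fun x => f x * f x ^+ n); first exact: bmfM.
by apply/funext => x; rewrite exprS.
Qed.

Lemma bmf_norm f : bmf f -> bmf (fun x => `|f x|).
Proof.
move=> [mf [M fM]]; split; first exact: measurableT_comp.
by exists M => x; rewrite normr_id.
Qed.

Lemma bmf_sum (I : Type) (r : seq I) (F : I -> T -> R) :
  (forall i, bmf (F i)) -> bmf (fun x => \sum_(i <- r) F i x).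
Proof.
move=> bF; elim: r => [|i r IH].
  rewrite [X in bmf X](_ : _ = fun=> 0); first exact: bmf_cst.
  by apply/funext => x; rewrite big_nil.
rewrite [X in bmf X](_ : _ = fun x => F i x + \sum_(j <- r) F j x).
  exact: bmfD.
by apply/funext => x; rewrite big_cons.
Qed.

Lemma bmf_indic (A : set T) : measurable A -> bmf (\1_A).
Proof.
move=> mA; split; first exact: measurable_indic.
by exists 1 => x; rewrite indicE; case: (_ \in _); rewrite ?normr1 ?normr0.
Qed.

Lemma bmf_integrable (mu : {measure set T -> \bar R}) f :
  mu setT = 1%E -> bmf f -> mu.-integrable setT (EFin \o f).
Proof.
move=> mu1 [mf [M fM]]; apply: measurable_bounded_integrable => //.
  by rewrite mu1 ltry.
exists M; split; first exact: num_real.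
by move=> N MN x _ /=; rewrite (le_trans (fM x))// ltW.
Qed.

End bounded_measurable.

Lemma bmf_comp (R : realType) (d d' : measure_display) (T : measurableType d)
    (T' : measurableType d') (f : T' -> R) (g : T -> T') :
  bmf f -> measurable_fun setT g -> bmf (fun x => f (g x)).
Proof.
move=> [mf [M fM]] mg; split; first exact: measurableT_comp.
by exists M.
Qed.

Section mean.
Context (R : realType) (d : measure_display) (T : measurableType d).
Implicit Types (f g : T -> R) (L : (T -> R) -> R).

(** Positive normalized linear functionals, with no continuity required. Integrals, mixtures and
    conditional means at a fixed history are all instances. *)
Record mean L : Prop := Mean {
  meanD : forall f g, bmf f -> bmf g -> L (fun x => f x + g x) = L f + L g;
  meanZ : forall (c : R) f, bmf f -> L (fun x => c * f x) = c * L f;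
  le_mean : forall f g, bmf f -> bmf g -> (forall x, f x <= g x) -> L f <= L g;
  mean1 : L (fun=> 1) = 1 }.

Lemma mean_cst L (c : R) : mean L -> L (fun=> c) = c.
Proof.
move=> mL; rewrite -[RHS]mulr1 -(mean1 mL) -(meanZ mL); last exact: bmf_cst.
by congr L; apply/funext => x; rewrite mulr1.
Qed.

Lemma meanB L f g : mean L -> bmf f -> bmf g ->
  L (fun x => f x - g x) = L f - L g.
Proof.
move=> mL bf bg; rewrite -[- L g]mulN1r -(meanZ mL)// -(meanD mL)//.
  by congr L; apply/funext => x; rewrite mulN1r.
exact: bmfZ.
Qed.

Lemma mean_ge0 L f : mean L -> bmf f -> (forall x, 0 <= f x) -> 0 <= L f.
Proof.
by move=> mL bf f0; rewrite -(mean_cst 0 mL); apply: (le_mean mL) => //; exact: bmf_cst.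
Qed.

Lemma mean_sum L (I : Type) (r : seq I) (F : I -> T -> R) : mean L ->
  (forall i, bmf (F i)) ->
  L (fun x => \sum_(i <- r) F i x) = \sum_(i <- r) L (F i).
Proof.
move=> mL bF; elim: r => [|i r IH].
  rewrite big_nil -[RHS](mean_cst 0 mL).
  by congr L; apply/funext => x; rewrite big_nil.
rewrite big_cons -IH -(meanD mL)//; last exact: bmf_sum.
by congr L; apply/funext => x; rewrite big_cons.
Qed.

(** Nonnegativity of the variance. *)
Lemma sqr_mean_le L f : mean L -> bmf f -> L f ^+ 2 <= L (fun x => f x ^+ 2).
Proof.
move=> mL bf; have b2 := bmfX 2 bf; have bZ := bmfZ (2 * L f) bf.
have bC : bmf (fun _ : T => L f ^+ 2) by exact: bmf_cst.
have : 0 <= L (fun x => f x ^+ 2 - 2 * L f * f x + L f ^+ 2).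
  apply: mean_ge0 => // [|x]; first by apply: bmfD => //; exact: bmfB.
  by rewrite (_ : _ + _ = (f x - L f) ^+ 2) ?sqr_ge0//; ring.
rewrite (meanD mL)//; last exact: bmfB.
by rewrite (meanB mL)// (meanZ mL)// mean_cst//; lra.
Qed.

Lemma mean_Rintegral (mu : {measure set T -> \bar R}) :
  mu setT = 1%E -> mean (fun f => \int[mu]_x f x).
Proof.
move=> mu1; split.
- by move=> f g bf bg; rewrite RintegralD//; exact: bmf_integrable.
- by move=> c f bf; rewrite RintegralZl//; exact: bmf_integrable.
- by move=> f g bf bg fg; apply: le_Rintegral => //; exact: bmf_integrable.
- by rewrite Rintegral_cst// mu1 mulr1.
Qed.

Lemma mean_mixture (I : finType) (w : I -> R) (L : I -> (T -> R) -> R) :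
  (forall i, 0 <= w i) -> \sum_i w i = 1 -> (forall i, mean (L i)) ->
  mean (fun f => \sum_i w i * L i f).
Proof.
move=> w0 w1 mL; split.
- move=> f g bf bg; rewrite -big_split; apply: eq_bigr => i _ /=.
  by rewrite (meanD (mL i))// mulrDr.
- move=> c f bf; rewrite mulr_sumr; apply: eq_bigr => i _.
  by rewrite (meanZ (mL i))// mulrCA.
- move=> f g bf bg fg; apply: ler_sum => i _; apply: ler_wpM2l => //.
  exact: (le_mean (mL i)).
- by rewrite -[RHS]w1; apply: eq_bigr => i _; rewrite (mean1 (mL i)) mulr1.
Qed.

Lemma count_le_bounds (n : nat) (y : R) : 0 <= y -> y <= n%:R ->
  y - 1 <= \sum_(i < n) (i.+1%:R <= y)%R%:R <= y.
Proof.
move=> y0 yn.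
(* The minima remove the hypothesis [y <= n%:R], which would not pass from n + 1 to n in the
   induction. *)
suff H : Num.min n%:R (y - 1) <= \sum_(i < n) (i.+1%:R <= y)%R%:R <= Num.min n%:R y.
  move: H => /andP[]; rewrite (min_r yn) min_r; last lra.
  by move=> -> ->.
elim: {yn} n => [|n IH].
  by rewrite big_ord0 ge_min lexx /= le_min lexx y0.
rewrite big_ord_recr /=; move: IH.
rewrite -(natr1 n) !ge_min !le_min => /andP[/orP h1 /andP[h2 h3]].
case: (leP (n%:R + 1) y) => hy /=; apply/andP; split.
- by apply/orP; left; case: h1; lra.
- by apply/andP; split; lra.
- by apply/orP; right; case: h1; lra.
- by apply/andP; split; lra.
Qed.

(* Uniform approximation of [f] from below by averages of indicators of its
   superlevel sets. *)
Lemma mean_le_indic (L1 L2 : (T -> R) -> R) (c : R) :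
  mean L1 -> mean L2 -> 0 <= c ->
  (forall A, measurable A -> L1 (\1_A) <= c * L2 (\1_A)) ->
  forall f, bmf f -> (forall x, 0 <= f x) -> L1 f <= c * L2 f.
Proof.
move=> m1 m2 c0 H f bf f0; have [mf [M fM]] := bf.
pose B := `|M| + 1.
have B0 : 0 < B by rewrite /B ltr_wpDl.
have fB x : f x <= B.
  by rewrite (le_trans (ler_norm _))// (le_trans (fM x))// /B ler_wpDr// ler_norm.
pose A n i := [set x | i.+1%:R <= n.+1%:R / B * f x].
have mA n i : measurable (A n i).
  rewrite -[A n i]setTI; apply: measurable_fun_le => //.
  by apply: measurable_funM => //; exact: measurable_cst.
pose F n x := \sum_(i < n.+1) B / n.+1%:R * \1_(A n i) x.
have bF n : bmf (F n).
  by apply: bmf_sum => i; apply: bmfZ; exact: bmf_indic.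
have LF L n : mean L -> L (F n) = \sum_(i < n.+1) B / n.+1%:R * L (\1_(A n i)).
  move=> mL; rewrite (mean_sum _ mL); last first.
    by move=> i; apply: bmfZ; exact: bmf_indic.
  by apply: eq_bigr => i _; rewrite (meanZ mL)//; exact: bmf_indic.
have Fbnd n x : f x - B / n.+1%:R <= F n x <= f x.
  have n0 : 0 < n.+1%:R :> R by rewrite ltr0n.
  have y0 : 0 <= n.+1%:R / B * f x.
    by rewrite mulr_ge0// divr_ge0// ltW.
  have yn : n.+1%:R / B * f x <= n.+1%:R.
    by rewrite -mulrA ger_pMr// mulrC ler_pdivrMr// mul1r.
  have /andP[] := count_le_bounds y0 yn.
  have -> : F n x = B / n.+1%:R * \sum_(i < n.+1)
      (i.+1%:R <= n.+1%:R / B * f x)%R%:R.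
    rewrite mulr_sumr; apply: eq_bigr => i _; rewrite indicE; congr (_ * (_)%:R).
    by congr nat_of_bool; apply/idP/idP => [/set_mem//|h]; exact/mem_set.
  set S := \sum_(i < _) _ => h1 h2.
  have c1 : 0 < B / n.+1%:R by rewrite divr_gt0.
  have e : B / n.+1%:R * (n.+1%:R / B * f x) = f x.
    by field; rewrite !gt_eqF.
  apply/andP; split.
    rewrite -[X in X - _]e -[X in _ - X]mulr1 -mulrBr.
    by rewrite ler_pM2l.
  by rewrite -[leRHS]e ler_pM2l.
(* The approximation error is paid only under [L1]; under [L2] the inequality [F n <= f]
   suffices. *)
have key n : L1 f <= c * L2 f + B / n.+1%:R.
  have h1 : L1 f <= L1 (F n) + B / n.+1%:R.
    rewrite -[X in _ + X](mean_cst _ m1) -(meanD m1)//; last exact: bmf_cst.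
    apply: (le_mean m1) => // [|x]; first by apply: bmfD => //; exact: bmf_cst.
    by have /andP[h _] := Fbnd n x; rewrite -lerBlDr.
  apply: (le_trans h1); rewrite lerD2r.
  apply: (@le_trans _ _ (c * L2 (F n))).
    rewrite !LF// mulr_sumr; apply: ler_sum => i _.
    rewrite mulrCA; apply: ler_wpM2l; last exact: H.
    by rewrite divr_ge0// ltW.
  rewrite ler_wpM2l//; apply: (le_mean m2) => // x.
  by have /andP[] := Fbnd n x.
apply/ler_addgt0Pr => e e0.
have [n] : exists n : nat, B / e < n.+1%:R.
  exists (Num.truncn (B / e)); exact: truncnS_gt.
rewrite ltr_pdivrMr// => Bn.
apply: (le_trans (key n)); rewrite lerD2l ler_pdivrMr ?ltr0n//.
by rewrite mulrC ltW.
Qed.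

(** Adding a bound of [f] makes it nonnegative; then [mean_le_indic] with constant 1 applies in both
    directions. *)
Lemma eq_mean_indic (L1 L2 : (T -> R) -> R) :
  mean L1 -> mean L2 ->
  (forall A, measurable A -> L1 (\1_A) = L2 (\1_A)) ->
  forall f, bmf f -> L1 f = L2 f.
Proof.
move=> m1 m2 H f bf; have [_ [M fM]] := bf.
have bg : bmf (fun x => f x + M) by apply: bmfD => //; exact: bmf_cst.
have g0 x : 0 <= f x + M by have := fM x; rewrite ler_norml; lra.
have : L1 (fun x => f x + M) = L2 (fun x => f x + M).
  apply/eqP; rewrite eq_le -[X in _ <= X]mul1r -[X in _ && (_ <= X)]mul1r.
  by rewrite !mean_le_indic// => A mA; rewrite mul1r H.
have bM : bmf (fun _ : T => M) by exact: bmf_cst.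
rewrite (meanD m1 bf bM) (meanD m2 bf bM) !mean_cst//.
exact: addIr.
Qed.

End mean.

Lemma mean_comp (R : realType) (d d' : measure_display) (T : measurableType d)
    (T' : measurableType d') (L : (T -> R) -> R) (K : (T' -> R) -> T -> R) :
  mean L -> (forall f, bmf f -> bmf (K f)) ->
  (forall x, mean (fun f => K f x)) -> mean (fun f => L (K f)).
Proof.
move=> mL bK mK; split.
- move=> f g bf bg; rewrite -(meanD mL (bK _ bf) (bK _ bg)); congr L.
  by apply/funext => x; rewrite (meanD (mK x)).
- move=> c f bf; rewrite -(meanZ mL c (bK _ bf)); congr L.
  by apply/funext => x; rewrite (meanZ (mK x)).
- move=> f g bf bg fg; apply: (le_mean mL) => [||x]; [exact: bK|exact: bK|].
  exact: (le_mean (mK x)).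
- by rewrite -[RHS](mean1 mL); congr L; apply/funext => x; exact: (mean1 (mK x)).
Qed.

(** * The conditional mean of one message *)

(* [M] is the mean over histories and [T x] the conditional mean of the next
   message on data point [x].  Privacy is assumed only after averaging over the
   history: the sigma-algebra of the messages need not be countably generated, so
   the privacy of transcripts gives no privacy for almost every history. *)
Section one_step.
Context (R : realType) (d d' : measure_display) (H : measurableType d)
  (H' : measurableType d') (k : nat) (Z : finType).
Variables (pr : H' -> H) (M : (H -> R) -> R)
  (T : 'I_k -> (H' -> R) -> H -> R) (p : Z -> 'I_k -> R) (kappa c : R).
Hypotheses (k_gt0 : (0 < k)%N) (mpr : measurable_fun setT pr) (mM : mean M)
  (bT : forall x F, bmf F -> bmf (T x F))
  (mT : forall x h, mean (fun F => T x F h))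
  (T_pr : forall x G F h, bmf G -> bmf F ->
    T x (fun y => G (pr y) * F y) h = G h * T x F h)
  (c_gt0 : 0 < c)
  (private : forall x x' F, bmf F -> (forall y, 0 <= F y) ->
    M (T x F) <= c * M (T x' F))
  (p_ge0 : forall z x, 0 <= p z x) (p_sum : forall z, \sum_x p z x = 1)
  (kappa_gt0 : 0 < kappa)
  (kappa_bound : forall f : Z -> R,
    \sum_x (\sum_z (k%:R * p z x - 1) * f z) ^+ 2 <= kappa * \sum_z f z ^+ 2).

Let TU (F : H' -> R) (h : H) : R := \sum_x k%:R^-1 * T x F h.

Let kR : k%:R != 0 :> R. Proof. by rewrite pnatr_eq0 -lt0n. Qed.

Let bTU F : bmf F -> bmf (TU F).
Proof. by move=> bF; apply: bmf_sum => x; apply: bmfZ; exact: bT. Qed.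

Let mTU h : mean (fun F => TU F h).
Proof.
apply: (@mean_mixture _ _ _ _ _ (fun x F => T x F h)) => //.
by rewrite sumr_const card_ord -[_ *+ _]mulr_natr mulVf.
Qed.

Let TU_pr G F h : bmf G -> bmf F ->
  TU (fun y => G (pr y) * F y) h = G h * TU F h.
Proof.
move=> bG bF; rewrite /TU mulr_sumr; apply: eq_bigr => x _.
by rewrite T_pr// mulrCA.
Qed.

Let bpr (G : H -> R) : bmf G -> bmf (fun y => G (pr y)).
Proof. by move=> bG; exact: bmf_comp. Qed.

Let MTU F : bmf F -> M (TU F) = \sum_x k%:R^-1 * M (T x F).
Proof.
move=> bF; rewrite /TU (mean_sum _ mM); last by move=> x; apply/bmfZ/bT.
by apply: eq_bigr => x _; rewrite (meanZ mM)//; exact: bT.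
Qed.

Let MTUc (a : R) : \sum_(x < k) k%:R^-1 * a = a.
Proof. by rewrite sumr_const card_ord -[_ *+ _]mulr_natr mulrAC mulVf// mul1r. Qed.

Let privU x F : bmf F -> (forall y, 0 <= F y) ->
  M (T x F) <= c * M (TU F) /\ M (TU F) <= c * M (T x F).
Proof.
move=> bF F0; rewrite MTU//; split.
  rewrite -[leLHS]MTUc mulr_sumr; apply: ler_sum => x' _.
  by rewrite mulrCA ler_wpM2l ?invr_ge0//; exact: private.
rewrite -[leRHS]MTUc; apply: ler_sum => x' _.
by rewrite ler_wpM2l ?invr_ge0//; exact: private.
Qed.

Let eta := c - c^-1.

(** Write g = (g + |g|) - |g|, a difference of nonnegative functions. Privacy bounds the first from
    above with factor c and the second from below with factor 1/c; both have the same mean under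
    [TU] since [g] is centered. *)
Let centered x g : bmf g -> M (TU g) = 0 ->
  M (T x g) <= eta * M (TU (fun y => `|g y|)).
Proof.
move=> bg g0; have bn := bmf_norm bg.
have mMT : mean (fun F => M (T x F)) by apply: mean_comp => //; exact: bT.
have [h1 _] := @privU x (fun y => g y + `|g y|) (bmfD bg bn)
  (fun y => ltac:(by have := ler_norm (- g y); rewrite normrN; lra)).
have [_ h2] := @privU x (fun y => `|g y|) bn (fun y => normr_ge0 _).
have e1 := meanD mMT bg bn; rewrite /= in e1.
have e2 : M (TU (fun y => g y + `|g y|)) = M (TU (fun y => `|g y|)).
  rewrite -[RHS]add0r -g0 -(meanD mM (bTU bg) (bTU bn)); congr M.
  by apply/funext => h; rewrite (meanD (mTU h)).
rewrite e1 e2 in h1.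
have h3 : c^-1 * M (TU (fun y => `|g y|)) <= M (T x (fun y => `|g y|)).
  by rewrite mulrC ler_pdivrMr// mulrC.
rewrite /eta mulrBl; lra.
Qed.

Variable F : Z -> H' -> R.
Hypotheses (bF : forall z, bmf (F z)) (F_ge0 : forall z y, 0 <= F z y)
  (F_le1 : forall z y, F z y <= 1).

Let A z h := \sum_x p z x * T x (F z) h.
Let u z h := TU (F z) h.
Let f z y := F z y - u z (pr y).
Let dl z x : R := k%:R * p z x - 1.
(** All alternatives are collected in one test function for each [x], so that absolute values are
    taken after the sum over [z] and the operator norm bound still applies. The weight [A z] depends
    on the history alone and leaves the conditional mean. *)
Let g x y := \sum_z dl z x * (A z (pr y) * f z y).

Let bA z : bmf (A z).
Proof. by apply: bmf_sum => x; apply: bmfZ; exact: bT. Qed.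

Let bu z : bmf (u z). Proof. exact: bTU. Qed.

Let bf z : bmf (f z).
Proof. by apply: bmfB => //; exact: bpr. Qed.

Let baf z : bmf (fun y => A z (pr y) * f z y).
Proof. by apply: bmfM => //; exact: bpr. Qed.

Let bg x : bmf (g x).
Proof. by apply: bmf_sum => z; exact: bmfZ. Qed.

Let A_ge0 z h : 0 <= A z h.
Proof.
apply: sumr_ge0 => x _; rewrite mulr_ge0//.
exact: (mean_ge0 (mT x h)).
Qed.

Let A_le1 z h : A z h <= 1.
Proof.
rewrite -(p_sum z); apply: ler_sum => x _.
rewrite -[leRHS]mulr1 ler_wpM2l// -(mean1 (mT x h)).
by apply: (le_mean (mT x h)) => //; exact: bmf_cst.
Qed.

Let T_f x z h : T x (f z) h = T x (F z) h - u z h.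
Proof.
rewrite /f (meanB (mT x h))//; last exact: bpr.
congr (_ - _).
rewrite -[RHS]mulr1 -(mean1 (mT x h)) -T_pr//; last exact: bmf_cst.
by congr (T x _ h); apply/funext => y; rewrite mulr1.
Qed.

Let TU_f z h : TU (f z) h = 0.
Proof.
rewrite /TU; under eq_bigr do rewrite T_f mulrBr.
by rewrite sumrB MTUc subrr.
Qed.

(** Decomposition of the second moment into conditional variance and squared conditional mean; the
    cross term vanishes by [TU_f]. *)
Let TU_sqr z h : TU (fun y => F z y ^+ 2) h = TU (fun y => f z y ^+ 2) h + u z h ^+ 2.
Proof.
have -> : (fun y => F z y ^+ 2) =
    fun y => f z y ^+ 2 + u z (pr y) * (2 * f z y + u z (pr y) * 1).
  by apply/funext => y; rewrite /f; ring.
have b1 : bmf (fun y => u z (pr y) * 1).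
  by apply: bmfM; [exact: bpr|exact: bmf_cst].
have b2 : bmf (fun y => 2 * f z y + u z (pr y) * 1).
  by apply: bmfD => //; exact: bmfZ.
rewrite (meanD (mTU h)); last 2 first.
- exact: bmfX.
- by apply: bmfM => //; exact: bpr.
rewrite TU_pr// (meanD (mTU h))//; last exact: bmfZ.
rewrite (meanZ (mTU h))// TU_f mulr0 add0r TU_pr//; last exact: bmf_cst.
by rewrite (mean1 (mTU h)) mulr1 expr2.
Qed.

Let TU_g x h : TU (g x) h = 0.
Proof.
rewrite /g (mean_sum _ (mTU h)); last by move=> z; exact: bmfZ.
by rewrite big1// => z _; rewrite (meanZ (mTU h))// TU_pr// TU_f !mulr0.
Qed.

(** Since (A - u)^2 is nonnegative, A^2 is at most u^2 + 2 A (A - u). As k (A - u) is the sum over x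
    of [dl z x * T x (f z)], the last term is the covariance with [g]. *)
Let sum_sqr_A h : \sum_z A z h ^+ 2 <=
  \sum_z u z h ^+ 2 + 2 / k%:R * \sum_x T x (g x) h.
Proof.
have -> : \sum_x T x (g x) h = \sum_z k%:R * (A z h * (A z h - u z h)).
  transitivity (\sum_x \sum_z dl z x * (A z h * (T x (F z) h - u z h))).
    apply: eq_bigr => x _.
    rewrite /g (mean_sum _ (mT x h)); last by move=> z; exact: bmfZ.
    by apply: eq_bigr => z _; rewrite (meanZ (mT x h))// T_pr// T_f.
  rewrite exchange_big; apply: eq_bigr => z _ /=.
  transitivity (A z h * \sum_x (k%:R * (p z x * T x (F z) h) -
      k%:R * (k%:R^-1 * T x (F z) h) - k%:R * (p z x * u z h)
      + u z h)).
    rewrite mulr_sumr; apply: eq_bigr => x _; rewrite /dl.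
    by field.
  rewrite big_split /= !sumrB -!mulr_sumr -mulr_suml p_sum sumr_const card_ord.
  have uE : \sum_x T x (F z) h = k%:R * u z h.
    by rewrite /u /TU -mulr_sumr mulrA divff// mul1r.
  by rewrite -/(A z h) uE -[_ *+ k]mulr_natl; field.
rewrite mulr_sumr -big_split /=; apply: ler_sum => z _.
have -> : 2 / k%:R * (k%:R * (A z h * (A z h - u z h))) = 2 * (A z h * (A z h - u z h)).
  by field.
by have := sqr_ge0 (A z h - u z h); nra.
Qed.

(** AM-GM with weight [kappa], chosen so that by [kappa_bound] and A <= 1 the quadratic part is at
    most the sum of the [f z y ^+ 2], which the conditional variance pays for. *)
Let sum_norm_g y : \sum_x 2 * eta / k%:R * `|g x y| <=
  kappa * eta ^+ 2 / k%:R + \sum_z f z y ^+ 2.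
Proof.
have h1 : \sum_x g x y ^+ 2 <= kappa * \sum_z f z y ^+ 2.
  apply: (le_trans (kappa_bound _)); rewrite ler_wpM2l ?(ltW kappa_gt0)//.
  apply: ler_sum => z _; rewrite exprMn ler_piMl ?sqr_ge0//.
  by rewrite expr_le1.
apply: (@le_trans _ _ (\sum_x (kappa * eta ^+ 2 / k%:R ^+ 2 + kappa^-1 * g x y ^+ 2))).
  apply: ler_sum => x _; rewrite -subr_ge0 -[g x y ^+ 2]real_normK ?num_real//.
  set v := `|g x y|.
  have -> : kappa * eta ^+ 2 / k%:R ^+ 2 + kappa^-1 * v ^+ 2
      - 2 * eta / k%:R * v = kappa * (eta / k%:R - kappa^-1 * v) ^+ 2.
    by field; rewrite kR gt_eqF.
  by rewrite mulr_ge0 ?sqr_ge0// ltW.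
rewrite big_split /= sumr_const card_ord -mulr_sumr; apply: lerD.
  by rewrite -mulr_natl le_eqVlt; apply/orP; left; apply/eqP; field.
by rewrite mulrC ler_pdivrMr// mulrC.
Qed.

Lemma one_step : \sum_z M (fun h => A z h ^+ 2) <=
  \sum_z M (fun h => \sum_x k%:R^-1 * T x (fun y => F z y ^+ 2) h)
  + kappa * (c - c^-1) ^+ 2 / k%:R.
Proof.
have MA : \sum_z M (fun h => A z h ^+ 2) <=
    \sum_z M (fun h => u z h ^+ 2) + 2 / k%:R * \sum_x M (T x (g x)).
  rewrite -(mean_sum _ mM); last by move=> z; exact: bmfX.
  rewrite -(mean_sum _ mM); last by move=> z; exact: bmfX.
  rewrite -(mean_sum _ mM); last by move=> x; exact: bT.
  have b1 : bmf (fun h => \sum_z u z h ^+ 2) by apply: bmf_sum => z; exact: bmfX.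
  have b2 : bmf (fun h => \sum_x T x (g x) h) by apply: bmf_sum => x; exact: bT.
  rewrite -(meanZ mM)// -(meanD mM)//; last exact: bmfZ.
  apply: (le_mean mM) => //; first by apply: bmf_sum => z; exact: bmfX.
  by apply: bmfD => //; exact: bmfZ.
apply: (le_trans MA).
have mMU : mean (fun F => M (TU F)) by exact: mean_comp.
have -> : \sum_z M (fun h => \sum_x k%:R^-1 * T x (fun y => F z y ^+ 2) h) =
    \sum_z M (TU (fun y => f z y ^+ 2)) + \sum_z M (fun h => u z h ^+ 2).
  rewrite -big_split; apply: eq_bigr => z _ /=.
  rewrite -(meanD mM); [|by apply/bTU/bmfX|exact: bmfX].
  by congr M; apply/funext => h; exact: TU_sqr.
(* The second moments of [u] cancel; the covariance term is left against the conditional variance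
   plus the error. *)
rewrite -[leRHS]addrA addrCA lerD2l.
have -> : \sum_z M (TU (fun y => f z y ^+ 2)) + kappa * (c - c^-1) ^+ 2 / k%:R =
    M (TU (fun y => kappa * eta ^+ 2 / k%:R + \sum_z f z y ^+ 2)).
  have b1 : bmf (fun y => \sum_z f z y ^+ 2) by apply: bmf_sum => z; exact: bmfX.
  rewrite (meanD mMU)//; last exact: bmf_cst.
  rewrite (mean_cst _ mMU) (mean_sum _ mMU) 1?addrC// => z; exact: bmfX.
apply: (@le_trans _ _ (M (TU (fun y => \sum_x 2 * eta / k%:R * `|g x y|)))).
  rewrite (mean_sum _ mMU); last by move=> x; exact/bmfZ/bmf_norm.
  rewrite mulr_sumr; apply: ler_sum => x _.
  rewrite (meanZ mMU); last exact: bmf_norm.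
  rewrite (_ : 2 * eta / k%:R = 2 / k%:R * eta); last by ring.
  rewrite -[leRHS]mulrA ler_wpM2l ?divr_ge0//; apply: centered => //.
  rewrite -[RHS](mean_cst 0 mM); congr M; apply/funext => h; exact: TU_g.
apply: (le_mean mMU); last exact: sum_norm_g.
- by apply: bmf_sum => x; exact/bmfZ/bmf_norm.
- by apply: bmfD; [exact: bmf_cst|apply: bmf_sum => z; exact: bmfX].
Qed.

End one_step.

(** * Protocols *)

Section drop_last.
Context (d d' : measure_display) (Omega : measurableType d)
  (Y : measurableType d') (t : nat).

Definition drop_last (h : Omega * t.+1.-tuple Y) : Omega * t.-tuple Y :=
  (h.1, [tuple tnth h.2 (widen_ord (leqnSn t) i) | i < t]).

Lemma measurable_drop_last : measurable_fun setT drop_last.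
Proof.
apply/measurable_fun_pairP; split => //=.
  rewrite [X in measurable_fun _ X](_ : _ = fst)//.
apply/measurable_fun_tnthP => i.
rewrite [X in measurable_fun _ X](_ : _ =
    (@tnth t.+1 Y ^~ (widen_ord (leqnSn t) i)) \o snd).
  by apply: measurableT_comp; [exact: measurable_tnth|exact: measurable_snd].
by apply/funext => h /=; rewrite tnth_mktuple.
Qed.

Lemma append_drop_lastK (h : Omega * t.-tuple Y) y :
  drop_last (append (h, y)) = h.
Proof.
case: h => w s; rewrite /drop_last /append /=; congr (_, _).
apply: eq_from_tnth => i; rewrite tnth_mktuple !(tnth_nth y) /=.
by rewrite nth_rcons size_tuple ltn_ord.
Qed.

Lemma measurable_append_section (h : Omega * t.-tuple Y)
    (A : set (Omega * t.+1.-tuple Y)) :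
  measurable A -> measurable [set y | A (append (h, y))].
Proof.
move=> mA; have mpre : measurable ((@append _ _ Omega Y t) @^-1` A).
  by rewrite -[X in measurable X]setTI; exact: measurable_append.
rewrite (_ : [set y | _] = xsection ((@append _ _ Omega Y t) @^-1` A) h).
  exact: measurable_xsection.
by apply/seteqP; split => y; rewrite /xsection/= inE.
Qed.

End drop_last.

Lemma Rintegral_indic (R : realType) (d : measure_display)
    (T : measurableType d) (mu : {measure set T -> \bar R}) (A : set T) :
  measurable A -> \int[mu]_x \1_A x = fine (mu A).
Proof. by move=> mA; rewrite /Rintegral integral_indic// setIT. Qed.

Section kernel_mean.
Context (R : realType) (d d' : measure_display) (Omega : measurableType d)
  (Y : measurableType d') (t : nat).
Variable K : R.-pker (Omega * t.-tuple Y)%type ~> Y.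

Definition kernel_mean (F : Omega * t.+1.-tuple Y -> R)
    (h : Omega * t.-tuple Y) : R :=
  \int[K h]_y F (append (h, y)).

Let bapp (F : Omega * t.+1.-tuple Y -> R) (h : Omega * t.-tuple Y) :
  bmf F -> bmf (fun y => F (append (h, y))).
Proof.
move=> bF; apply: bmf_comp => //.
apply: (measurableT_comp (@measurable_append _ _ _ _ _)).
exact: pair1_measurable.
Qed.

Lemma mean_kernel_mean h : mean (fun F => kernel_mean F h).
Proof.
have mK := @mean_Rintegral _ _ _ (K h) (prob_kernel h).
split.
- by move=> f g bf bg; exact: (meanD mK (bapp h bf) (bapp h bg)).
- by move=> c f bf; exact: (meanZ mK c (bapp h bf)).
- move=> f g bf bg fg; exact: (le_mean mK (bapp h bf) (bapp h bg)).
- exact: (mean1 mK).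
Qed.

Lemma bmf_kernel_mean F : bmf F -> bmf (kernel_mean F).
Proof.
move=> bF; have [mF [C FC]] := bF; split; last first.
  exists C => h; rewrite ler_norml; apply/andP; split.
    rewrite -(mean_cst (- C) (mean_kernel_mean h)).
    apply: (le_mean (mean_kernel_mean h)) => // [|x]; first exact: bmf_cst.
    by have := FC x; rewrite ler_norml => /andP[].
  rewrite -(mean_cst C (mean_kernel_mean h)).
  apply: (le_mean (mean_kernel_mean h)) => // [|x]; first exact: bmf_cst.
  by have := FC x; rewrite ler_norml => /andP[].
have bC : bmf (fun _ : Omega * t.+1.-tuple Y => C) by exact: bmf_cst.
(* Measurability of kernel integrals is applied to a nonnegative integrand, hence the shift by the
   bound [C]. *)
rewrite (_ : kernel_mean F = fun h => kernel_mean (fun x => F x + C) h - C).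
  apply: measurable_funB; last exact: measurable_cst.
  apply: measurableT_comp => //.
  apply: (measurable_fun_integral_finite_kernel
    (fun hy => (F (append hy) + C)%:E)) => //.
    by move=> hy; rewrite lee_fin; have := FC (append hy); rewrite ler_norml; lra.
  apply/measurable_EFinP; apply: measurable_funD; last exact: measurable_cst.
  by apply: measurableT_comp => //; exact: measurable_append.
apply/funext => h; rewrite (meanD (mean_kernel_mean h))//.
by rewrite (mean_cst _ (mean_kernel_mean h)) addrK.
Qed.

Lemma kernel_mean_drop_last G F h : bmf F ->
  kernel_mean (fun y => G (drop_last y) * F y) h = G h * kernel_mean F h.
Proof.
move=> bF; have mK := @mean_Rintegral _ _ _ (K h) (prob_kernel h).
rewrite /kernel_mean -(meanZ mK); last exact: bapp.
by apply: eq_Rintegral => y _; rewrite append_drop_lastK.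
Qed.

(** Both sides are means, and on indicators they agree by the definition of [transcript_step]. *)
Lemma Rintegral_transcript_step (mu : probability (Omega * t.-tuple Y)%type R) F :
  bmf F -> \int[transcript_step mu K]_x F x = \int[mu]_h kernel_mean F h.
Proof.
move=> bF; apply: (@eq_mean_indic _ _ _
    (fun F => \int[transcript_step mu K]_x F x)
    (fun F => \int[mu]_h kernel_mean F h)) => //.
- by apply: mean_Rintegral; exact: probability_setT.
- apply: (@mean_comp _ _ _ _ _ (fun G => \int[mu]_h G h) kernel_mean).
  + by apply: mean_Rintegral; exact: probability_setT.
  + exact: bmf_kernel_mean.
  + exact: mean_kernel_mean.
- move=> A mA; rewrite Rintegral_indic// /Rintegral /transcript_step; congr fine.
  apply: eq_integral => h _; rewrite /kernel_mean.
  have mAh := measurable_append_section h mA.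
  rewrite (_ : (fun y => _) = \1_[set y | A (append (h, y))]); last first.
    by apply/funext => y; rewrite !indicE; congr (nat_of_bool _)%:R.
  rewrite Rintegral_indic// fineK//.
  rewrite ge0_fin_numE// (le_lt_trans _ (ltry 1))// -(@prob_kernel _ _ _ _ _ K h).
  by apply: le_measure => //; rewrite inE.
Qed.

End kernel_mean.

Lemma neighborsE (m k : nat) (s s' : {ffun 'I_m -> 'I_k}) :
  neighbors s s' = (#|[pred i | s i != s' i]| == 1%N).
Proof.
rewrite /neighbors; congr (_ == _); apply: eq_card => i; rewrite [RHS]inE.
by apply/idP/idP => [/set_mem//|h]; exact/mem_set.
Qed.

Section snoc.
Context (k t : nat).

Definition snoc (s : {ffun 'I_t -> 'I_k}) (x : 'I_k) : {ffun 'I_t.+1 -> 'I_k} :=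
  [ffun i => if unlift ord_max i is Some j then s j else x].

Lemma snoc_widen s x i : snoc s x (widen_ord (leqnSn t) i) = s i.
Proof.
rewrite ffunE (_ : widen_ord _ i = lift ord_max i) ?liftK//.
by apply: val_inj; rewrite /= /bump leqNgt ltn_ord.
Qed.

Lemma snoc_max s x : snoc s x ord_max = x.
Proof. by rewrite ffunE unlift_none. Qed.

Lemma snoc_bij : bijective (fun sx : {ffun 'I_t -> 'I_k} * 'I_k => snoc sx.1 sx.2).
Proof.
exists (fun s : {ffun 'I_t.+1 -> 'I_k} =>
  ([ffun i => s (widen_ord (leqnSn t) i)], s ord_max)).
  move=> [s x] /=; rewrite snoc_max; congr (_, _).
  by apply/ffunP => i; rewrite ffunE snoc_widen.
move=> s /=; apply/ffunP => i; rewrite ffunE.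
case: unliftP => [j ->|->//]; rewrite ffunE; congr (s _).
by apply: val_inj; rewrite /= /bump leqNgt ltn_ord.
Qed.

End snoc.

Lemma is_distribution_uniform (R : realType) (k : nat) :
  (0 < k)%N -> is_distribution (uniform_distribution R k).
Proof.
move=> k0; split=> [x|]; first by rewrite invr_ge0.
by rewrite sumr_const card_ord -[_ *+ _]mulr_natr mulVf// pnatr_eq0 -lt0n.
Qed.

Section protocol.
Context (R : realType) (k : nat) (d d' : measure_display)
  (Omega : measurableType d) (Y : measurableType d').
Variable Pi : seq_protocol R k Omega Y.

Lemma transcript_of_snoc t (s : {ffun 'I_t -> 'I_k}) x :
  transcript_of Pi (snoc s x) =
  transcript_step (transcript_of Pi s) (randomizer Pi t x).
Proof.
rewrite /= snoc_max; congr (transcript_step (transcript_of Pi _) _).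
by apply/funext => i; exact: snoc_widen.
Qed.

(** The real-valued extension of [output_prob] from events to functions of the transcript. *)
Definition iid_mean (t : nat) (p : 'I_k -> R)
    (F : Omega * t.-tuple Y -> R) : R :=
  \sum_(s : {ffun 'I_t -> 'I_k})
    (\prod_(i < t) p (s i)) * \int[transcript_of Pi s]_h F h.

Lemma mean_iid_mean t p : is_distribution p -> mean (@iid_mean t p).
Proof.
move=> [p0 p1]; 
apply: (@mean_mixture _ _ _ _ (fun s : {ffun 'I_t -> 'I_k} => \prod_i p (s i))
  (fun s F => \int[transcript_of Pi s]_h F h)).
- by move=> s; exact: prodr_ge0.
- rewrite -(bigA_distr_bigA (fun _ => p)) /=.
  by rewrite big1.
- by move=> s; apply: mean_Rintegral; exact: probability_setT.
Qed.

(** Tower property: the last sample is independent of the earlier history, so it is averaged out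
    inside. *)
Lemma iid_meanS t p F : bmf F ->
  iid_mean p F =
  iid_mean p (fun h => \sum_x p x * kernel_mean (randomizer Pi t x) F h).
Proof.
move=> bF; transitivity (\sum_(s : {ffun 'I_t -> 'I_k}) \sum_x
    (\prod_(i < t.+1) p (snoc s x i)) *
    \int[transcript_step (transcript_of Pi s) (randomizer Pi t x)]_h F h).
  rewrite /iid_mean (reindex _ (onW_bij _ (@snoc_bij k t))) pair_big.
  by apply: eq_bigr => sx _; rewrite transcript_of_snoc.
apply: eq_bigr => s _.
have mP := @mean_Rintegral _ _ _ (transcript_of Pi s) (probability_setT _).
rewrite (mean_sum _ mP); last by move=> x; apply: bmfZ; exact: bmf_kernel_mean.
rewrite mulr_sumr; apply: eq_bigr => x _.
rewrite (meanZ mP); last exact: bmf_kernel_mean.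
rewrite Rintegral_transcript_step// big_ord_recr /= snoc_max mulrA.
by congr (_ * _ * _); apply: eq_bigr => i _; rewrite snoc_widen.
Qed.

(** Events of the shorter history are pulled back along [drop_last]. Appending one fixed sample [x0]
    preserves their probability and the neighbor relation. *)
Lemma locally_private_pred t eps : (0 < k)%N ->
  locally_private Pi t.+1 eps -> locally_private Pi t eps.
Proof.
move=> k0 lp s s' ss' E mE; have x0 := Ordinal k0.
have mE' : measurable ((@drop_last _ _ Omega Y t) @^-1` E).
  by rewrite -[X in measurable X]setTI; exact: measurable_drop_last.
have margE (s1 : {ffun 'I_t -> 'I_k}) :
    transcript Pi (snoc s1 x0) ((@drop_last _ _ Omega Y t) @^-1` E) =
    transcript Pi s1 E.
  rewrite /transcript transcript_of_snoc /= /transcript_step.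
  rewrite -[in RHS](setIT E) -integral_indic//; apply: eq_integral => h _.
  rewrite indicE; case: (boolP (h \in E)) => hE.
    rewrite (_ : [set y | _] = setT) ?prob_kernel//.
    by apply/seteqP; split => y //= _; rewrite append_drop_lastK; exact: set_mem.
  rewrite (_ : [set y | _] = set0) ?measure0//.
  apply/seteqP; split => y //=; rewrite append_drop_lastK => /mem_set.
  by rewrite (negbTE hE).
rewrite -!margE; apply: lp => //.
move: ss'; rewrite !neighborsE => /eqP <-.
rewrite -[X in _ == X](card_imset _ (@lift_inj _ ord_max)).
apply/eqP/eq_card => i; rewrite inE !ffunE.
case: unliftP => [j ->|->].
  by rewrite (mem_imset _ _ (@lift_inj _ ord_max)) inE.
rewrite eqxx; apply/esym/negbTE/imsetP => -[j _ /eqP].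
by rewrite (negbTE (neq_lift _ _)).
Qed.

(** For fixed earlier samples only the last entry changes, so privacy of the transcript applies to
    events, and [mean_le_indic] passes to functions. *)
Lemma private_iid_mean t eps p x x' F : 0 <= eps -> is_distribution p ->
  locally_private Pi t.+1 eps -> bmf F -> (forall h, 0 <= F h) ->
  iid_mean p (kernel_mean (randomizer Pi t x) F) <=
  expR eps * iid_mean p (kernel_mean (randomizer Pi t x') F).
Proof.
move=> eps0 [p0 p1] lp bF F0; rewrite /iid_mean mulr_sumr.
apply: ler_sum => s _; rewrite mulrCA ler_wpM2l//; first exact: prodr_ge0.
have snocE x1 : \int[transcript_of Pi s]_h kernel_mean (randomizer Pi t x1) F h =
    \int[transcript_of Pi (snoc s x1)]_h F h.
  by rewrite transcript_of_snoc Rintegral_transcript_step.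
rewrite !snocE.
apply: (@mean_le_indic _ _ _
  (fun F => \int[transcript_of Pi (snoc s x)]_h F h)
  (fun F => \int[transcript_of Pi (snoc s x')]_h F h)) => //.
- by apply: mean_Rintegral; exact: probability_setT.
- by apply: mean_Rintegral; exact: probability_setT.
- move=> A mA; rewrite !Rintegral_indic//.
  have fin (s1 : 'I_t.+1 -> 'I_k) : transcript_of Pi s1 A \is a fin_num.
    exact: fin_num_measure.
  (* Equal inputs are not neighbors; there the bound follows from [0 <= eps]. *)
  have [->|xx'] := eqVneq x x'.
    rewrite ler_peMl ?fine_ge0//.
    by rewrite -expR0 ler_expR.
  rewrite -lee_fin EFinM !fineK; [|exact: fin|exact: fin].
  apply: (lp (snoc s x) (snoc s x')) => //.
  rewrite neighborsE -(card1 (@ord_max t)); apply/eqP/eq_card => i.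
  rewrite !inE !ffunE.
  case: unliftP => [j ->|->]; last by rewrite xx' eqxx.
  by rewrite eqxx eq_sym (negbTE (neq_lift _ _)).
Qed.

(** Induction on [t]: the mean over the last message under [p z] turns [F z] into [G z], and
    [one_step] compares second moments under the uniform law. The functions must depend on [z],
    because [G z] does even when [F z] does not. *)
Lemma second_moment_bound (Z : finType) (p : Z -> 'I_k -> R) (kappa eps : R) t :
  (0 < k)%N -> 0 <= eps -> (forall z, is_distribution (p z)) -> 0 < kappa ->
  (forall f : Z -> R,
    \sum_x (\sum_z (k%:R * p z x - 1) * f z) ^+ 2 <= kappa * \sum_z f z ^+ 2) ->
  locally_private Pi t eps ->
  forall F : Z -> Omega * t.-tuple Y -> R, (forall z, bmf (F z)) ->
  (forall z h, 0 <= F z h) -> (forall z h, F z h <= 1) ->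
  \sum_z iid_mean (p z) (F z) ^+ 2 <=
  \sum_z iid_mean (uniform_distribution R k) (fun h => F z h ^+ 2) +
  t%:R * (kappa * (expR eps - expR (- eps)) ^+ 2 / k%:R).
Proof.
move=> k0 eps0 dp kappa0 kb.
have dU := is_distribution_uniform R k0.
elim: t => [|t IH] lp F bF F0 F1.
  (* Without users the law of the transcript does not depend on [p z], and only the variance
     inequality remains. *)
  rewrite mul0r addr0; apply: ler_sum => z _.
  rewrite (_ : iid_mean (p z) (F z) = iid_mean (uniform_distribution R k) (F z)).
    by apply: sqr_mean_le => //; exact: mean_iid_mean.
  by apply: eq_bigr => s _; rewrite !big_ord0.
pose K x := randomizer Pi t x.
pose G z h := \sum_x p z x * kernel_mean (K x) (F z) h.
have bG z : bmf (G z).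
  by apply: bmf_sum => x; apply: bmfZ; exact: bmf_kernel_mean.
have mK x h := mean_kernel_mean (K x) h.
have G0 z h : 0 <= G z h.
  apply: sumr_ge0 => x _; rewrite mulr_ge0//; first by case: (dp z).
  exact: (mean_ge0 (mK x h)).
have G1 z h : G z h <= 1.
  rewrite -(dp z).2; apply: ler_sum => x _.
  rewrite -[leRHS]mulr1 ler_wpM2l//; first by case: (dp z).
  rewrite -(mean1 (mK x h)).
  by apply: (le_mean (mK x h)) => //; exact: bmf_cst.
under eq_bigr do rewrite iid_meanS//.
apply: (le_trans (IH (locally_private_pred k0 lp) G bG G0 G1)).
rewrite -natr1 mulrDl mul1r [_ * _ + _]addrC addrA lerD2r expRN.
have := @one_step _ _ _ _ _ k Z (@drop_last _ _ Omega Y t)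
  (@iid_mean t (uniform_distribution R k)) (fun x => kernel_mean (K x)) p kappa
  (expR eps) k0 (@measurable_drop_last _ _ Omega Y t) (mean_iid_mean t dU)
  (fun x F bF => bmf_kernel_mean (K x) bF) mK
  (fun x G F h _ bF => kernel_mean_drop_last (K x) G h bF) (expR_gt0 eps)
  (fun x x' F bF F0 => private_iid_mean x x' eps0 dU lp bF F0)
  (fun z => (dp z).1) (fun z => (dp z).2) kappa0 kb F bF F0 F1.
move=> /le_trans; apply; rewrite lerD2r; apply: ler_sum => z _.
by rewrite [leRHS]iid_meanS//; exact: bmfX.
Qed.

Lemma output_probE m (out : Omega * m.-tuple Y -> bool) p b :
  measurable_fun setT out ->
  output_prob Pi out p b =
  (iid_mean p (\1_[set h | out h = b]))%:E.
Proof.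
move=> mout; rewrite /output_prob /iid_mean -sumEFin; apply: eq_bigr => s _.
have mA : measurable [set h | out h = b].
  by rewrite -[X in measurable X]setTI; exact: (mout measurableT [set b]).
rewrite EFinM Rintegral_indic// fineK//.
exact: fin_num_measure.
Qed.

End protocol.

(** * The lower bound *)

(** The upper bounds on [s] will give [lam <= 1] and [lam <= 2 * alpha]; the lower bound keeps the
    square norm of the perturbation of order alpha^2 k. *)
Lemma hard_support_size (R : realType) (k : nat) (alpha alpha0 : R) :
  (2 <= k)%N -> 0 < alpha -> alpha <= alpha0 -> alpha0 < 1 ->
  alpha <= 1 - k%:R^-1 ->
  exists s : nat, [/\ (0 < s)%N, (s.*2 <= k)%N,
    s%:R <= (1 - alpha) * k%:R & k%:R <= (2 / (1 - alpha0) + 3) * s%:R].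
Proof.
move=> k2 a0 aa0 a01 ak.
have k0 : 0 < k%:R :> R by rewrite ltr0n (leq_trans _ k2).
have y1 : 1 <= (1 - alpha) * k%:R.
  by rewrite -ler_pdivrMr// div1r; lra.
set y := (1 - alpha) * k%:R in y1 *.
have y0 : 0 <= y by lra.
have b0 : 0 < 1 - alpha0 by rewrite subr_gt0.
have ty : (Num.truncn y)%:R <= y by rewrite truncn_le.
have t0 : (0 < Num.truncn y)%N by rewrite truncn_gt0.
have h0 : (0 < k./2)%N by rewrite half_gt0.
(* The integer part is positive because alpha <= 1 - 1/k. It is at least y / 2, which gives 2 / (1 -
   alpha0); the term 3 comes from k <= 3 * (k./2) for k at least 2. *)
exists (minn (Num.truncn y) k./2); split.
- by rewrite leq_min t0.
- by rewrite -geq_half_double geq_minr.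
- by rewrite (le_trans _ ty)// ler_nat geq_minl.
- have b3 : 0 < 2 / (1 - alpha0) by rewrite divr_gt0.
  rewrite mulrDl; have [_|_] := leqP (Num.truncn y) k./2.
    have ltS := truncnS_gt y; rewrite -natr1 in ltS.
    have t1 : 1 <= (Num.truncn y)%:R :> R by rewrite ler1n.
    have : k%:R <= 2 / (1 - alpha0) * (Num.truncn y)%:R.
      rewrite mulrAC ler_pdivlMr//; apply: (@le_trans _ _ y).
        by rewrite /y mulrC ler_wpM2r//; lra.
      lra.
    by move=> /le_trans; apply; rewrite lerDl mulr_ge0.
  have : (k <= 3 * k./2)%N.
    rewrite -[X in (X <= _)%N]odd_double_half mulSn mul2n leq_add2r.
    by rewrite (leq_trans _ h0)// leq_b1.
  rewrite -(ler_nat R) natrM => /le_trans; apply.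
  by rewrite lerDr mulr_ge0// ltW.
Qed.

Lemma hard_family (R : realType) (k : nat) (alpha alpha0 : R) :
  (2 <= k)%N -> 0 < alpha -> alpha <= alpha0 -> alpha0 < 1 ->
  alpha <= 1 - k%:R^-1 ->
  exists p : {perm 'I_k} -> 'I_k -> R,
    [/\ forall z, is_distribution (p z),
        forall z, alpha <= dTV (p z) (uniform_distribution R k) &
        forall f : {perm 'I_k} -> R,
          \sum_x (\sum_z (k%:R * p z x - 1) * f z) ^+ 2 <=
          #|{perm 'I_k}|%:R * (8 * alpha ^+ 2 * (2 / (1 - alpha0) + 3)) *
          \sum_z f z ^+ 2].
Proof.
move=> k2 a0 aa0 a01 ak.
have [s [s0 sk sa ks]] := hard_support_size k2 a0 aa0 a01 ak.
have k0 : 0 < k%:R :> R by rewrite ltr0n (leq_trans _ k2).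
have sR : 0 < s%:R :> R by rewrite ltr0n.
have s2k : 2 * s%:R <= k%:R :> R by rewrite -natrM ler_nat mul2n.
have s_le : (s <= k)%N by rewrite (leq_trans _ sk)// -addnn leq_addr.
(* This weight puts every alternative at distance exactly [alpha]. *)
pose lam := alpha * k%:R / (k%:R - s%:R).
have ks0 : 0 < k%:R - s%:R :> R by lra.
have lam0 : 0 <= lam by rewrite /lam divr_ge0 ?mulr_ge0 ?ltW.
have lam1 : lam <= 1 by rewrite /lam ler_pdivrMr//; lra.
have lam2 : lam <= 2 * alpha by rewrite /lam ler_pdivrMr//; nra.
pose d := @step_perturbation R k s lam.
have d0 : \sum_x d x = 0 by exact: sum_step_perturbation.
have dperm (g : R -> R) (z : {perm 'I_k}) : \sum_x g (d (z x)) = \sum_x g (d x).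
  by rewrite [RHS](reindex_inj (@perm_inj _ z)).
exists (fun z x => (1 + d (z x)) / k%:R); split.
- move=> z; split.
    move=> x; rewrite divr_ge0 ?ler0n//.
    by have := step_perturbation_geN1 s (z x) lam0 lam1; rewrite -/d; lra.
  rewrite -mulr_suml big_split /= (dperm id) d0 sumr_const card_ord addr0.
  by rewrite divff// gt_eqF.
- move=> z; rewrite /dTV /uniform_distribution.
  rewrite (eq_bigr (fun x => k%:R^-1 * `|d (z x)|)); last first.
    move=> x _; rewrite mulrDl mul1r addrAC subrr add0r normrM mulrC.
    by rewrite ger0_norm// invr_ge0 ltW.
  rewrite -mulr_sumr (dperm Num.norm) sum_norm_step_perturbation// /lam.
  by rewrite le_eqVlt; apply/orP; left; apply/eqP; field; rewrite !gt_eqF.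
- move=> f.
  have N0 : 0 < #|{perm 'I_k}|%:R :> R.
    by rewrite ltr0n; apply/card_gt0P; exists 1%g.
  have b0 : 0 < 2 / (1 - alpha0) + 3 by rewrite addr_gt0// divr_gt0// subr_gt0.
  have K0 : 0 < #|{perm 'I_k}|%:R * (8 * alpha ^+ 2 * (2 / (1 - alpha0) + 3)).
    by rewrite !mulr_gt0// exprn_gt0.
  have e z x : k%:R * ((1 + d (z x)) / k%:R) - 1 = d (z x).
    by rewrite mulrC divfK ?gt_eqF// addrC addKr.
  under eq_bigr do under eq_bigr do rewrite e.
  apply: (@dual_operator_bound R _ _ (fun (z : {perm 'I_k}) x => d (z x))) => // v.
  apply: (le_trans (sum_perm_quadratic_form v k2 d0)).
  rewrite ler_wpM2r//; first by apply: sumr_ge0 => x _; exact: sqr_ge0.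
  rewrite ler_wpM2l ?(ltW N0)// sum_sqr_step_perturbation//.
  (* The constant 8 is 2 from the permutation average times 4 from lam^2 <= 4 alpha^2; [B] bounds k
     / s. *)
  set B := 2 / (1 - alpha0) + 3 in ks b0 *.
  have h1 : k%:R ^+ 2 / s%:R - k%:R <= k%:R * B.
    apply: (@le_trans _ _ (k%:R ^+ 2 / s%:R)); first by lra.
    rewrite ler_pdivrMr// expr2 -mulrA ler_wpM2l//; exact: ltW.
  have h2 : lam ^+ 2 <= 4 * alpha ^+ 2.
    rewrite (_ : 4 * alpha ^+ 2 = (2 * alpha) ^+ 2); last by ring.
    by rewrite lerXn2r// nnegrE// mulr_ge0// ltW.
  rewrite ler_pdivrMr//.
  have kB : 0 <= k%:R * B by rewrite mulr_ge0// ltW.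
  have := ler_wpM2l (sqr_ge0 lam) h1.
  have := ler_wpM2r kB h2.
  lra.
Qed.

(** Factor out exp(eps) and use 1 - exp(-2 eps) <= 2 eps. *)
Lemma expR_subN_le (R : realType) (eps eps0 : R) : 0 <= eps -> eps <= eps0 ->
  0 <= expR eps - expR (- eps) <= 2 * eps * expR eps0.
Proof.
move=> e0 ee; apply/andP; split.
  by rewrite subr_ge0 ler_expR; lra.
have h : 1 - expR (- (2 * eps)) <= 2 * eps.
  by have := expR_ge1Dx (- (2 * eps)); lra.
rewrite (_ : expR (- eps) = expR eps * expR (- (2 * eps))); last first.
  by rewrite -expRD; congr expR; ring.
rewrite -[X in X - _]mulr1 -mulrBr.
apply: (@le_trans _ _ (expR eps * (2 * eps))).
  by rewrite ler_wpM2l// expR_ge0.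
by rewrite mulrC ler_wpM2l ?ler_expR//; lra.
Qed.

Unset Implicit Arguments.

(* alpha <= alpha0 < 1 and alpha <= 1 - 1/k instead of alpha <= 1: every p on [k] satisfies
   dTV p U_k <= 1 - 1/k, so beyond that there is nothing to test and m = 0
   suffices; and at alpha = 1 - 1/k the only alternatives are point masses,
   which O(1/eps^2) samples detect for every k, so no c serves all alpha < 1. *)
Theorem theorem4 (R : realType) (eps0 alpha0 : R) (eps0_gt0 : 0 < eps0)
    (alpha0_lt1 : alpha0 < 1) :
  exists c : R, 0 < c /\
  forall (k : nat) (alpha eps : R), (2 <= k)%N ->
    0 < alpha -> alpha <= alpha0 -> alpha <= 1 - k%:R^-1 ->
    0 < eps -> eps <= eps0 ->
  forall (m : nat) (d d' : measure_display)
    (Omega : measurableType d) (Y : measurableType d')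
    (Pi : seq_protocol R k Omega Y) (out : Omega * m.-tuple Y -> bool),
    locally_private Pi m eps ->
    uniformity_tester Pi alpha out ->
    c * (k%:R / (alpha ^+ 2 * eps ^+ 2)) <= m%:R.
Proof.
pose B := 2 / (1 - alpha0) + 3.
have B0 : 0 < B by rewrite addr_gt0// divr_gt0// subr_gt0.
have E0 := expR_gt0 eps0; set E := expR eps0 in E0 *.
(* 288 = 9 * 8 * 4: the gap 4/9 - 1/3 = 1/9, the 8 of [hard_family], and the 4 of eta^2 <= (2 eps
   E)^2. *)
exists (288 * B * E ^+ 2)^-1; split.
  by rewrite invr_gt0 !mulr_gt0// exprn_gt0.
move=> k alpha eps k2 a0 aa0 ak e0 ee m d d' Omega Y Pi out lp [mout HU Hp].
have [p [dp far kb]] := hard_family k2 a0 aa0 alpha0_lt1 ak.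
have kn0 : (0 < k)%N by exact: leq_trans k2.
have k0 : 0 < k%:R :> R by rewrite ltr0n.
have N0 : 0 < #|{perm 'I_k}|%:R :> R.
  by rewrite ltr0n; apply/card_gt0P; exists 1%g.
set N := #|{perm 'I_k}|%:R in N0 kb.
have kappa0 : 0 < N * (8 * alpha ^+ 2 * B) by rewrite !mulr_gt0// exprn_gt0.
pose F (h : Omega * m.-tuple Y) : R := \1_[set h | out h = false] h.
have mA b : measurable [set h | out h = b].
  by rewrite -[X in measurable X]setTI; exact: (mout measurableT [set b]).
have bF : bmf F by exact: bmf_indic.
have F01 h : 0 <= F h <= 1 by rewrite /F indicE; case: (_ \in _); rewrite ?lexx ?ler01.
have F0 h : 0 <= F h by have /andP[] := F01 h.
have F1 h : F h <= 1 by have /andP[] := F01 h.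
have := second_moment_bound kn0 (ltW e0) dp kappa0 kb lp (fun=> bF)
  (fun=> F0) (fun=> F1).
(* For an indicator the second moment is the mean, hence at most 1/3 under uniform. *)
have FX : (fun h => F h ^+ 2) = F.
  by apply/funext => h; rewrite /F indicE; case: (_ \in _); rewrite ?expr1n ?expr0n.
have dU := is_distribution_uniform R kn0.
have U3 : iid_mean Pi (uniform_distribution R k) F <= 3^-1.
  move: HU; rewrite output_probE// lee_fin.
  have mU := mean_iid_mean Pi m dU.
  have -> : F = fun h => 1 - \1_[set h | out h = true] h.
    apply/funext => h; rewrite /F !indicE.
    have e b : (h \in [set h | out h = b]) = (out h == b).
      by apply/idP/eqP => [/set_mem//|hb]; exact/mem_set.
    by rewrite !e; case: (out h) => /=; rewrite ?subrr ?subr0.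
  rewrite (meanB mU); [|exact: bmf_cst|exact: bmf_indic].
  by rewrite (mean1 mU); lra.
have P3 z : 4 / 9 <= iid_mean Pi (p z) F ^+ 2.
  have := Hp _ (dp z) (far z); rewrite output_probE// lee_fin -/F => h.
  rewrite (_ : 4 / 9 = (2 / 3) ^+ 2 :> R); last by field.
  by apply: lerXn2r => //; rewrite nnegrE; lra.
rewrite FX sumr_const -[_ *+ #|_|]mulr_natl -/N => main.
have lower : N * (4 / 9) <= \sum_z iid_mean Pi (p z) F ^+ 2.
  rewrite /N mulr_natl -sumr_const; exact: ler_sum.
have {main lower} main := le_trans lower main.
set eta := expR eps - expR (- eps) in main.
have eta2 : eta ^+ 2 <= (2 * eps * E) ^+ 2.
  have /andP[h1 h2] := expR_subN_le (ltW e0) ee.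
  by rewrite lerXn2r// nnegrE// (le_trans h1 h2).
(* [kappa] is proportional to the number [N] of alternatives, so [N] cancels. *)
have {}main : N * 9^-1 <= N * (m%:R * (8 * alpha ^+ 2 * B * eta ^+ 2 / k%:R)).
  have := ler_wpM2l (ltW N0) U3; move: main.
  rewrite (_ : m%:R * (N * (8 * alpha ^+ 2 * B) * eta ^+ 2 / k%:R) =
    N * (m%:R * (8 * alpha ^+ 2 * B * eta ^+ 2 / k%:R))); last by ring.
  lra.
rewrite ler_pM2l// in main.
have c0 : 0 < 288 * B * E ^+ 2 * (alpha ^+ 2 * eps ^+ 2).
  by rewrite !mulr_gt0// exprn_gt0.
rewrite (_ : _ * (k%:R / _) = k%:R / (288 * B * E ^+ 2 * (alpha ^+ 2 * eps ^+ 2))).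
  rewrite ler_pdivrMr//.
  have : 9^-1 * k%:R <= m%:R * (8 * alpha ^+ 2 * B * eta ^+ 2).
    by move: main; rewrite mulrA ler_pdivlMr.
  have : m%:R * (8 * alpha ^+ 2 * B * eta ^+ 2) <=
      m%:R * (8 * alpha ^+ 2 * B * (2 * eps * E) ^+ 2).
    by rewrite ler_wpM2l// ler_wpM2l// !mulr_ge0// ?sqr_ge0// ltW.
  rewrite (_ : m%:R * (8 * alpha ^+ 2 * B * (2 * eps * E) ^+ 2) =
    9^-1 * (m%:R * (288 * B * E ^+ 2 * (alpha ^+ 2 * eps ^+ 2)))); last by field.
  lra.
by field; rewrite !gt_eqF.
Qed.
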